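(* Let $\mathcal{C}$ and $\mathcal{D}$ be two finite (ordered) inverse categories and let $\mathbb{K}$ be a commutative unital ring. If $\mathcal{D}$ is an enlargement of $\mathcal{C}$, then the convolution algebras $\mathbb{K}\mathcal{C}$ and $\mathbb{K}\mathcal{D}$ are Morita equivalent.
   Context: An inverse category is a category $\mathcal{C}$ in which every arrow $s:X\to Y$ has a unique arrow $s^\circ:Y\to X$ with $ss^\circ s=s$ and $s^\circ ss^\circ=s^\circ$; it is finite if its set of arrows is finite. The composite $st$ means first $t$, then $s$. $\mathcal{C}$ also denotes its set of arrows and $\mathcal{C}^{(0)}$ its set of objects. Put $id(s)=s^\circ s$, $ir(s)=ss^\circ$. $E(\mathcal{C}(X))$ is the set of idempotent arrows $X\to X$ in $\mathcal{C}$. The convolution algebra $\mathbb{K}\mathcal{C}$ is the free $\mathbb{K}$-module on the set of arrows of $\mathcal{C}$, with product given on the basis by the composite $st$ if it exists and $0$ otherwise. An ordered inverse category is an inverse category with a partial order $\leqslant$ on its arrows such that, for arrows $s,t,s',t'$ and idempotent arrows $e,f$: (I) $s\leqslant s'$, $t\leqslant t'$ imply $st\leqslant s't'$ when both composites are defined; (II) $s\leqslant t$ implies $id(s)\leqslant id(t)$ and $ir(s)\leqslant ir(t)$; (III) if $e\leqslant id(s)$ there is a unique arrow ${}_{e|}s\leqslant s$ with $id({}_{e|}s)=e$; (IV) if $f\leqslant ir(t)$ there is a unique arrow $t_{|f}\leqslant t$ with $ir(t_{|f})=f$. Let $\mathcal{C}$ be an ordered inverse subcategory of the ordered inverse category $\mathcal{D}$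 (a subcategory closed under $(\ )^\circ$ which is an ordered inverse category with the induced order). $\mathcal{D}$ is an enlargement of $\mathcal{C}$ if: (I) for each $X\in\mathcal{C}^{(0)}$, $E(\mathcal{C}(X))$ is an order ideal (down-closed subset) of $E(\mathcal{D}(X))$; (II) if $X,Y\in\mathcal{C}^{(0)}$, $e\in E(\mathcal{C}(X))$, $f\in E(\mathcal{C}(Y))$ and $s:X\to Y$ in $\mathcal{D}$ satisfies $se=s=fs$, then $s\in\mathcal{C}$; (III) for each $Y\in\mathcal{D}^{(0)}$ and $f\in E(\mathcal{D}(Y))$ there are $X\in\mathcal{C}^{(0)}$, $e\in E(\mathcal{C}(X))$ and $s:X\to Y$ in $\mathcal{D}$ with $s^\circ s=e$ and $ss^\circ=f$. *)

(* Defs.v *)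
From HB Require Import structures.
From mathcomp Require Import all_boot all_order all_algebra.

Set Implicit Arguments.
Unset Strict Implicit.
Unset Printing Implicit Defensive.
Import GRing.Theory.
Local Open Scope ring_scope.

(* Only the set of arrows is required to be finite; finiteness of the set of
   objects follows, since [idm] is injective.  The composite [compose s t] means
   first t, then s; it is a total operation, but its value is meaningful only
   when [composable s t] and is otherwise unspecified. *)
Record finCategory := FinCategory {
  ob : eqType;
  ar : finType;
  dom : ar -> ob;
  cod : ar -> ob;
  idm : ob -> ar;
  compose : ar -> ar -> ar;
  dom_idm : forall X, dom (idm X) = X;
  cod_idm : forall X, cod (idm X) = X;
  dom_compose : forall s t, dom s = cod t -> dom (compose s t) = dom t;
  cod_compose : forall s t, dom s = cod t -> cod (compose s t) = cod s;
  composeA : forall s t u, dom s = cod t -> dom t = cod u ->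
    compose s (compose t u) = compose (compose s t) u;
  compose_idm_l : forall s, compose (idm (cod s)) s = s;
  compose_idm_r : forall s, compose s (idm (dom s)) = s
}.

Definition composable (C : finCategory) (s t : ar C) : bool := dom s == cod t.

Definition idempotent_arrow (C : finCategory) (e : ar C) : Prop :=
  dom e = cod e /\ compose e e = e.

(* e \in E(C(X)) *)
Definition idempotent_at (C : finCategory) (X : ob C) (e : ar C) : Prop :=
  [/\ dom e = X, cod e = X & compose e e = e].

Definition is_inverse (C : finCategory) (s t : ar C) : Prop :=
  [/\ dom t = cod s, cod t = dom s,
      compose (compose s t) s = s & compose (compose t s) t = t].

Record finInvCategory := FinInvCategory {
  cat_of_inv :> finCategory;
  inv : ar cat_of_inv -> ar cat_of_inv;
  inv_inverse : forall s, is_inverse s (inv s);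
  inv_unique : forall s t, is_inverse s t -> t = inv s
}.

Definition id_of (C : finInvCategory) (s : ar C) : ar C := compose (inv s) s.
Definition ir_of (C : finInvCategory) (s : ar C) : ar C := compose s (inv s).

Record finOrdInvCategory := FinOrdInvCategory {
  inv_of_ord :> finInvCategory;
  ole : rel (ar inv_of_ord);
  ole_refl : reflexive ole;
  ole_anti : antisymmetric ole;
  ole_trans : transitive ole;
  ole_compose : forall s t s' t', ole s s' -> ole t t' ->
    composable s t -> composable s' t' -> ole (compose s t) (compose s' t');
  ole_id_ir : forall s t, ole s t ->
    ole (id_of s) (id_of t) /\ ole (ir_of s) (ir_of t);
  ole_restr : forall s e, idempotent_arrow e -> ole e (id_of s) ->
    exists! r, ole r s /\ id_of r = e;
  ole_corestr : forall t f, idempotent_arrow f -> ole f (ir_of t) ->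
    exists! r, ole r t /\ ir_of r = f
}.

(* C as an ordered inverse subcategory of D, presented by its inclusion, which
   is injective on objects and on arrows; [sub_ole] says that the order of C is
   the one induced by D. *)
Record ordInvSubcategory (C D : finOrdInvCategory) := OrdInvSubcategory {
  sub_ob : ob C -> ob D;
  sub_ar : ar C -> ar D;
  sub_ob_inj : injective sub_ob;
  sub_ar_inj : injective sub_ar;
  sub_dom : forall s, dom (sub_ar s) = sub_ob (dom s);
  sub_cod : forall s, cod (sub_ar s) = sub_ob (cod s);
  sub_idm : forall X, sub_ar (idm X) = idm (sub_ob X);
  sub_compose : forall s t, composable s t ->
    sub_ar (compose s t) = compose (sub_ar s) (sub_ar t);
  sub_inv : forall s, sub_ar (inv s) = inv (sub_ar s);
  sub_ole : forall s t, ole s t = ole (sub_ar s) (sub_ar t)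
}.

Record is_enlargement (C D : finOrdInvCategory) (i : ordInvSubcategory C D) :
    Prop := IsEnlargement {
  enl_ideal : forall X e f,
    idempotent_at X e -> idempotent_at (sub_ob i X) f -> ole f (sub_ar i e) ->
    exists2 f0, idempotent_at X f0 & f = sub_ar i f0;
  enl_full : forall X Y e f s,
    idempotent_at X e -> idempotent_at Y f ->
    dom s = sub_ob i X -> cod s = sub_ob i Y ->
    compose s (sub_ar i e) = s -> compose (sub_ar i f) s = s ->
    exists s0, s = sub_ar i s0;
  enl_cover : forall Y f, idempotent_at Y f ->
    exists X e s, [/\ idempotent_at X e, dom s = sub_ob i X, cod s = Y,
      id_of s = sub_ar i e & ir_of s = f]
}.

(* The free K-module on the arrows of C.  The carrier is a fresh constant so
   that it does not inherit the pointwise product of {ffun ar C -> K}. *)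
Definition convalg (K : comPzRingType) (C : finCategory) : Type :=
  {ffun ar C -> K^o}.

HB.instance Definition _ (K : comPzRingType) (C : finCategory) :=
  GRing.Lmodule.copy (convalg K C) {ffun ar C -> K^o}.

Section ConvolutionAlgebra.
Variables (K : comPzRingType) (C : finCategory).
Local Notation KC := (convalg K C).
Implicit Types (f g h : KC) (s t u : ar C).

Definition conv_coef f s : K := (f : {ffun ar C -> K^o}) s.

Definition arrow s : KC := [ffun t => (t == s)%:R].

Definition arrow_mul s t : KC :=
  if composable s t then arrow (compose s t) else 0.

Definition conv_mul f g : KC :=
  \sum_s \sum_t (conv_coef f s * conv_coef g t) *: arrow_mul s t.

(* A sum over the identity arrows a = idm (dom a), i.e. over the objects. *)
Definition conv_one : KC := \sum_(a | a == idm (dom a)) arrow a.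

Lemma conv_expand f : f = \sum_s conv_coef f s *: arrow s.
Proof.
apply/ffunP=> t; rewrite sum_ffunE (bigD1 t) //= big1 => [|s /negPf nst].
  by rewrite !ffunE eqxx addr0 /GRing.scale /= mulr1.
by rewrite !ffunE eq_sym nst /GRing.scale /= mulr0.
Qed.

Lemma conv_coefD f g s : conv_coef (f + g) s = conv_coef f s + conv_coef g s.
Proof. by rewrite /conv_coef ffunE. Qed.

Lemma conv_coefZ (k : K) f s : conv_coef (k *: f) s = k * conv_coef f s.
Proof. by rewrite /conv_coef ffunE. Qed.

Lemma conv_coef_arrow s t : conv_coef (arrow s) t = (t == s)%:R.
Proof. by rewrite /conv_coef ffunE. Qed.

Lemma conv_mulDl : left_distributive conv_mul +%R.
Proof.
move=> f g h; rewrite -big_split; apply: eq_bigr => s _ /=.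
rewrite -big_split; apply: eq_bigr => t _ /=.
by rewrite conv_coefD mulrDl scalerDl.
Qed.

Lemma conv_mulDr : right_distributive conv_mul +%R.
Proof.
move=> f g h; rewrite -big_split; apply: eq_bigr => s _ /=.
rewrite -big_split; apply: eq_bigr => t _ /=.
by rewrite conv_coefD mulrDr scalerDl.
Qed.

Lemma conv_mulZl (k : K) f g : conv_mul (k *: f) g = k *: conv_mul f g.
Proof.
rewrite scaler_sumr; apply: eq_bigr => s _.
rewrite scaler_sumr; apply: eq_bigr => t _.
by rewrite conv_coefZ scalerA mulrA.
Qed.

Lemma conv_mulZr (k : K) f g : conv_mul f (k *: g) = k *: conv_mul f g.
Proof.
rewrite scaler_sumr; apply: eq_bigr => s _.
rewrite scaler_sumr; apply: eq_bigr => t _.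
by rewrite conv_coefZ scalerA mulrCA.
Qed.

Lemma conv_mul0l g : conv_mul 0 g = 0.
Proof. by rewrite -[X in conv_mul X](scale0r 0) conv_mulZl scale0r. Qed.

Lemma conv_mul0r f : conv_mul f 0 = 0.
Proof. by rewrite -[X in conv_mul _ X](scale0r 0) conv_mulZr scale0r. Qed.

Lemma conv_mul_suml (I : finType) (P : pred I) (F : I -> KC) g :
  conv_mul (\sum_(i | P i) F i) g = \sum_(i | P i) conv_mul (F i) g.
Proof.
apply: (big_morph (conv_mul^~ g)) => [f1 f2|]; first by apply: conv_mulDl.
by apply: conv_mul0l.
Qed.

Lemma conv_mul_sumr (I : finType) (P : pred I) (F : I -> KC) f :
  conv_mul f (\sum_(i | P i) F i) = \sum_(i | P i) conv_mul f (F i).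
Proof.
apply: (big_morph (conv_mul f)) => [f1 f2|]; first by apply: conv_mulDr.
by apply: conv_mul0r.
Qed.

Lemma conv_mul_arrow s t : conv_mul (arrow s) (arrow t) = arrow_mul s t.
Proof.
rewrite /conv_mul (bigD1 s) //= (bigD1 t) //= !conv_coef_arrow !eqxx mulr1 scale1r.
rewrite big1 => [|t' /negPf nt]; last by rewrite !conv_coef_arrow nt mulr0 scale0r.
rewrite big1 ?addr0 // => s' /negPf ns; rewrite big1 // => t' _.
by rewrite !conv_coef_arrow ns mul0r scale0r.
Qed.

Lemma conv_mul_arrowA s t u :
  conv_mul (arrow s) (conv_mul (arrow t) (arrow u)) =
  conv_mul (conv_mul (arrow s) (arrow t)) (arrow u).
Proof.
rewrite !conv_mul_arrow /arrow_mul.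
have [/eqP tu|ntu] := boolP (composable t u);
  have [/eqP st|nst] := boolP (composable s t);
  rewrite ?conv_mul0l ?conv_mul0r ?conv_mul_arrow /arrow_mul //.
- by rewrite /composable cod_compose // dom_compose // st tu !eqxx composeA.
- by rewrite /composable cod_compose // -/(composable s t) (negPf nst).
- by rewrite /composable dom_compose // -/(composable t u) (negPf ntu).
Qed.

Lemma conv_mulA : associative conv_mul.
Proof.
move: conv_mulZl conv_mulZr conv_mul_suml conv_mul_sumr conv_mul_arrowA.
move: conv_mul => mul Zl Zr Sl Sr EA.
have E1 s t h : mul (arrow s) (mul (arrow t) h)
              = mul (mul (arrow s) (arrow t)) h.
  rewrite (conv_expand h) (Sr _ _ _ (arrow t)).
  rewrite (Sr _ _ _ (arrow s)) (Sr _ _ _ (mul _ _)).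
  by apply: eq_bigr => u _; rewrite !Zr EA.
have E2 s g h : mul (arrow s) (mul g h)
              = mul (mul (arrow s) g) h.
  rewrite (conv_expand g) (Sr _ _ _ (arrow s)).
  rewrite !(Sl _ _ _ h) (Sr _ _ _ (arrow s)).
  by apply: eq_bigr => t _; rewrite !(Zl, Zr) E1.
move=> f g h; rewrite (conv_expand f) (Sl _ _ _ g).
rewrite (Sl _ _ _ h) (Sl _ _ _ (mul g h)).
by apply: eq_bigr => s _; rewrite !Zl E2.
Qed.

Lemma conv_mul1l : left_id conv_one conv_mul.
Proof.
move=> f; rewrite (conv_expand f) conv_mul_sumr; apply: eq_bigr => t _.
rewrite conv_mulZr; congr (_ *: _).
rewrite conv_mul_suml (bigD1 (idm (cod t))) ?dom_idm //= big1 => [|a].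
  by rewrite conv_mul_arrow /arrow_mul /composable dom_idm eqxx compose_idm_l addr0.
case/andP=> /eqP aid nat; rewrite conv_mul_arrow /arrow_mul /composable.
by case: eqP => // dat; rewrite -dat -aid eqxx in nat.
Qed.

Lemma conv_mul1r : right_id conv_one conv_mul.
Proof.
move=> f; rewrite (conv_expand f) conv_mul_suml; apply: eq_bigr => s _.
rewrite conv_mulZl; congr (_ *: _).
rewrite conv_mul_sumr (bigD1 (idm (dom s))) ?dom_idm //= big1 => [|a].
  by rewrite conv_mul_arrow /arrow_mul /composable cod_idm eqxx compose_idm_r addr0.
case/andP=> /eqP aid nas; rewrite conv_mul_arrow /arrow_mul /composable.
case: eqP => // dsa; have ca : cod a = dom a by rewrite aid cod_idm dom_idm.
by rewrite dsa ca -aid eqxx in nas.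
Qed.

End ConvolutionAlgebra.

(* A pzRing because KC is the zero ring when C is empty or K is zero. *)
HB.instance Definition _ (K : comPzRingType) (C : finCategory) :=
  GRing.Zmodule_isPzRing.Build (convalg K C)
    (@conv_mulA K C) (@conv_mul1l K C) (@conv_mul1r K C)
    (@conv_mulDl K C) (@conv_mulDr K C).

Lemma arrowM (K : comPzRingType) (C : finCategory) (s t : ar C) :
  arrow K s * arrow K t = if composable s t then arrow K (compose s t) else 0.
Proof. exact: conv_mul_arrow. Qed.

(* MathComp's algType excludes the zero ring, so the K-algebra structure of KC
   is recorded by its structure morphism K -> KC, which is central. *)
Definition conv_scalar (K : comPzRingType) (C : finCategory) (k : K) :
  convalg K C := k *: (1 : convalg K C).

Lemma conv_scalarMl (K : comPzRingType) (C : finCategory) (k : K)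
  (f : convalg K C) : conv_scalar C k * f = k *: f.
Proof. by rewrite [LHS]conv_mulZl; congr (_ *: _); apply: mul1r. Qed.

Lemma conv_scalarMr (K : comPzRingType) (C : finCategory) (k : K)
  (f : convalg K C) : f * conv_scalar C k = k *: f.
Proof. by rewrite [LHS]conv_mulZr; congr (_ *: _); apply: mulr1. Qed.

Lemma conv_scalar_zmod (K : comPzRingType) (C : finCategory) :
  zmod_morphism (@conv_scalar K C).
Proof. by move=> k l; rewrite /conv_scalar scalerBl. Qed.

Lemma conv_scalar_monoid (K : comPzRingType) (C : finCategory) :
  monoid_morphism (@conv_scalar K C).
Proof.
split=> [|k l]; first by rewrite /conv_scalar scale1r.
by rewrite conv_scalarMl /conv_scalar scalerA.
Qed.

HB.instance Definition _ (K : comPzRingType) (C : finCategory) :=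
  GRing.isZmodMorphism.Build K (convalg K C) (@conv_scalar K C)
    (@conv_scalar_zmod K C).
HB.instance Definition _ (K : comPzRingType) (C : finCategory) :=
  GRing.isMonoidMorphism.Build K (convalg K C) (@conv_scalar K C)
    (@conv_scalar_monoid K C).

Definition conv_structure (K : comPzRingType) (C : finCategory) :
  {rmorphism K -> convalg K C} := @conv_scalar K C.

(* Functors A-Mod -> B-Mod between categories of left modules over K-algebras
   (with structure morphisms iA and iB) that are K-linear on Hom-sets, the
   scalar k acting on a module as iA k, resp. iB k.  Morphisms of modules are
   compared pointwise, since {linear M -> N} is a bundled type. *)
Record modFunctor (K A B : pzRingType)
    (iA : {rmorphism K -> A}) (iB : {rmorphism K -> B}) := ModFunctor {
  fobj : lmodType A -> lmodType B;
  fmor : forall M N : lmodType A, {linear M -> N} -> {linear fobj M -> fobj N};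
  fmor_ext : forall (M N : lmodType A) (u v : {linear M -> N}),
    u =1 v -> fmor u =1 fmor v;
  fmor_id : forall (M : lmodType A) (u : {linear M -> M}),
    u =1 id -> fmor u =1 id;
  fmor_comp : forall (M N P : lmodType A) (u : {linear N -> P})
    (v : {linear M -> N}) (w : {linear M -> P}),
    w =1 u \o v -> fmor w =1 fmor u \o fmor v;
  fmor_linear : forall (M N : lmodType A) (k : K) (u v w : {linear M -> N}),
    (forall x, w x = iA k *: u x + v x) ->
    forall y, fmor w y = iB k *: fmor u y + fmor v y
}.

(* A natural isomorphism from the identity functor to G \o F. *)
Record natIsoToComp (K A B : pzRingType)
    (iA : {rmorphism K -> A}) (iB : {rmorphism K -> B})
    (F : modFunctor iA iB) (G : modFunctor iB iA) := NatIsoToComp {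
  nat_iso : forall M : lmodType A, {linear M -> fobj G (fobj F M)};
  nat_iso_bij : forall M, bijective (nat_iso M);
  nat_iso_natural : forall (M N : lmodType A) (u : {linear M -> N}) (x : M),
    nat_iso N (u x) = fmor G (fmor F u) (nat_iso M x)
}.

Definition morita_equivalent (K A B : pzRingType)
    (iA : {rmorphism K -> A}) (iB : {rmorphism K -> B}) : Prop :=
  exists (F : modFunctor iA iB) (G : modFunctor iB iA),
    inhabited (natIsoToComp F G) /\ inhabited (natIsoToComp G F).

(* Main.v *)
Require Import Defs.
From HB Require Import structures.
From mathcomp Require Import all_boot all_order all_algebra.

Set Implicit Arguments.
Unset Strict Implicit.
Unset Printing Implicit Defensive.
Import GRing.Theory.
Local Open Scope ring_scope.

(** Write A for the convolution algebra of C, B for that of D, and e for the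
    sum in B of the identities of the objects of C.

    Fullness, applied to the identities of two objects of C, says that C is a
    full subcategory of D ([enlargement_full]).  Hence A is the corner e B e:
    multiplying an arrow of D by e on both sides keeps it if its ends are
    objects of C, that is if it is an arrow of C, and kills it otherwise
    ([conv_incl_restr]).

    Covering, applied to the identity of an object Y of D, gives an arrow
    s : X -> Y from an object of C with s s^o = 1_Y.  Since 1_X is a summand of
    e, we get s e s^o = 1_Y, and the sum over Y exhibits 1 as an element of
    B e B ([conv_incl1_full]).  So e is a full idempotent, and a full corner is
    Morita equivalent to the ring ([full_corner_morita]).

    To avoid tensor products in that last step, both functors of the
    equivalence are built from matrices.  If phi sends A to I x I matrices over
    B, respecting sums and products but not necessarily 1, then A acts on
    phi(1) V^I for every B-module V; this is [ind_functor].  The inclusion of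
    the corner is such a phi with 1 x 1 matrices, and it sends V to e V.  In
    the other direction write 1 = sum_j s_j e t_j; then b |-> (e t_j b s_l e)
    sends B to matrices over the corner.  Both composites have the form
    b |-> (u_k b w_l) with sum_k w_k u_k = 1, and x |-> (u_k x) is then a
    natural isomorphism with inverse v |-> sum_k w_k v_k
    ([comp_nat_iso]). *)

(** * Modules induced along a matrix-valued homomorphism *)

(** A ring homomorphism from A to the I x I matrices over B that may send 1 to
    a nontrivial idempotent.  It is presented by its entries, so that I may be
    any finite type, empty or not. *)
Record matrixHom (A B : pzRingType) (I : finType) := MatrixHom {
  mh_fun :> I -> I -> A -> B;
  mh_zmod : forall i j, zmod_morphism (mh_fun i j);
  mh_mul : forall i j a b,
    mh_fun i j (a * b) = \sum_k mh_fun i k a * mh_fun k j b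
}.

HB.instance Definition _ (A B : pzRingType) (I : finType)
    (phi : matrixHom A B I) i j :=
  GRing.isZmodMorphism.Build A B (phi i j) (mh_zmod phi i j).

Section InducedModule.
Variables (A B : pzRingType) (I : finType) (phi : matrixHom A B I).

Definition mh_act (V : lmodType B) a (v : {ffun I -> V}) : {ffun I -> V} :=
  [ffun i => \sum_j phi i j a *: v j].

Lemma mh_actM (V : lmodType B) a b (v : {ffun I -> V}) :
  mh_act (a * b) v = mh_act a (mh_act b v).
Proof.
apply/ffunP=> i; rewrite !ffunE.
under eq_bigr => j _ do rewrite mh_mul scaler_suml.
rewrite exchange_big; apply: eq_bigr => k _ /=.
by rewrite ffunE scaler_sumr; apply: eq_bigr => j _; rewrite scalerA.
Qed.

Lemma mh_act_zmod (V : lmodType B) a : zmod_morphism (@mh_act V a).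
Proof.
move=> v w; apply/ffunP=> i; rewrite !ffunE -sumrB.
by apply: eq_bigr => j _; rewrite !ffunE scalerBr.
Qed.

HB.instance Definition _ (V : lmodType B) a :=
  GRing.isZmodMorphism.Build _ _ (@mh_act V a) (@mh_act_zmod V a).

Lemma mh_actDl (V : lmodType B) (v : {ffun I -> V}) :
  {morph (@mh_act V)^~ v : a b / a + b}.
Proof.
move=> a b; apply/ffunP=> i; rewrite !ffunE -big_split.
by apply: eq_bigr => j _; rewrite raddfD scalerDl.
Qed.

(** The summand phi(1) V^I of V^I, on which A acts unitally. *)
Definition mh_fixed (V : lmodType B) : {pred {ffun I -> V}} :=
  [pred v | mh_act 1 v == v].

Lemma mh_fixed_zmod (V : lmodType B) : zmod_closed (@mh_fixed V).
Proof.
split=> [|v w]; rewrite !inE ?raddf0 // => /eqP fv /eqP fw.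
by rewrite mh_act_zmod fv fw.
Qed.

HB.instance Definition _ (V : lmodType B) :=
  GRing.isZmodClosed.Build _ (@mh_fixed V) (@mh_fixed_zmod V).

Record induced (V : lmodType B) := Induced {
  ind_val : {ffun I -> V};
  ind_valP : ind_val \in @mh_fixed V
}.

Section Instances.
Variable V : lmodType B.
HB.instance Definition _ := [isSub for @ind_val V].
HB.instance Definition _ := [Choice of induced V by <:].
HB.instance Definition _ := [SubChoice_isSubZmodule of induced V by <:].

Lemma ind_fixed (v : induced V) : mh_act 1 (ind_val v) = ind_val v.
Proof. exact/eqP/(ind_valP v). Qed.

Lemma mh_act_fixed a (v : {ffun I -> V}) :
  mh_act 1 v = v -> mh_act a v \in @mh_fixed V.
Proof. by move=> fv; rewrite inE -mh_actM mul1r. Qed.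

Definition ind_scale a (v : induced V) : induced V :=
  Induced (mh_act_fixed a (ind_fixed v)).

Lemma ind_scaleA a b v : ind_scale a (ind_scale b v) = ind_scale (a * b) v.
Proof. by apply: val_inj; rewrite /= mh_actM. Qed.

Lemma ind_scale1 : left_id 1 ind_scale.
Proof. by move=> v; apply: val_inj; apply: ind_fixed. Qed.

Lemma ind_scaleDr : right_distributive ind_scale +%R.
Proof. by move=> a v w; apply: val_inj; rewrite /= raddfD. Qed.

Lemma ind_scaleDl v : {morph ind_scale^~ v : a b / a + b}.
Proof. by move=> a b; apply: val_inj; rewrite /= mh_actDl. Qed.

HB.instance Definition _ := GRing.Zmodule_isLmodule.Build A (induced V)
  ind_scaleA ind_scale1 ind_scaleDr ind_scaleDl.

Lemma ind_scaleE a (v : induced V) i :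
  ind_val (a *: v) i = \sum_j phi i j a *: ind_val v j.
Proof. by rewrite ffunE. Qed.

Lemma ind_addE (v w : induced V) i :
  ind_val (v + w) i = ind_val v i + ind_val w i.
Proof. by rewrite ffunE. Qed.

Lemma ind_sumE (L : finType) (F : L -> induced V) i :
  ind_val (\sum_l F l) i = \sum_l ind_val (F l) i.
Proof.
apply: (big_morph (fun v => ind_val v i)) => [v w|]; first exact: ind_addE.
by rewrite ffunE.
Qed.

Lemma ind_eqP (v w : induced V) :
  (forall i, ind_val v i = ind_val w i) -> v = w.
Proof. by move=> vw; apply: val_inj; apply/ffunP. Qed.

Lemma ind_inP (v : {ffun I -> V}) :
  (forall i, \sum_j phi i j 1 *: v j = v i) -> v \in @mh_fixed V.
Proof. by move=> fv; rewrite inE; apply/eqP/ffunP => i; rewrite ffunE. Qed.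

Lemma ind_fixedE (v : induced V) i :
  \sum_j phi i j 1 *: ind_val v j = ind_val v i.
Proof. by rewrite -[in RHS](scale1r v) ind_scaleE. Qed.
End Instances.

Section Map.
Variables (V W : lmodType B) (u : {linear V -> W}).

Lemma ind_map_fixed (v : induced V) :
  [ffun i => u (ind_val v i)] \in @mh_fixed W.
Proof.
apply: ind_inP => i; rewrite ffunE -[in RHS]ind_fixedE linear_sum.
by apply: eq_bigr => j _; rewrite ffunE linearZ_LR.
Qed.

Definition ind_map (v : induced V) : induced W := Induced (ind_map_fixed v).

Lemma ind_mapE (v : induced V) i : ind_val (ind_map v) i = u (ind_val v i).
Proof. by rewrite ffunE. Qed.

Lemma ind_map_linear : linear ind_map.
Proof.
move=> a v w; apply: ind_eqP => i.
rewrite !(ind_addE, ind_mapE, ind_scaleE) linearD linear_sum; congr (_ + _).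
by apply: eq_bigr => j _; rewrite ind_mapE linearZ_LR.
Qed.

HB.instance Definition _ :=
  GRing.isLinear.Build A (induced V) (induced W) *:%R ind_map ind_map_linear.
End Map.

Section Functor.
Variables (K : pzRingType) (iA : {rmorphism K -> A}) (iB : {rmorphism K -> B}).
Hypothesis phiK : forall i j k a, phi i j (iA k * a) = iB k * phi i j a.

(** On phi(1) V^I the scalar k acts through the diagonal matrix iB k times
    phi(1), that is coordinatewise. *)
Lemma ind_scaleK (V : lmodType B) k (v : induced V) i :
  ind_val (iA k *: v) i = iB k *: ind_val v i.
Proof.
rewrite ind_scaleE -[in RHS]ind_fixedE scaler_sumr.
by apply: eq_bigr => j _; rewrite scalerA -phiK mulr1.
Qed.

Definition ind_functor : modFunctor iB iA.
Proof.
exists (fun V => induced V : lmodType A)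
       (fun V W u => ind_map u : {linear induced V -> induced W}).
- by move=> V W u v uv x; apply: ind_eqP => i; rewrite !ind_mapE uv.
- by move=> V u u1 x; apply: ind_eqP => i; rewrite ind_mapE u1.
- by move=> V W Z u v w wE x; apply: ind_eqP => i; rewrite !ind_mapE wE.
- move=> V W k u v w wE x; apply: ind_eqP => i.
  by rewrite ind_addE ind_scaleK !ind_mapE wE.
Defined.
End Functor.
End InducedModule.

(** * Composites of induction functors that are isomorphic to the identity *)

Section CompositeIsomorphism.
Variables (A B : pzRingType) (I J : finType).
Variables (phi : matrixHom A B I) (psi : matrixHom B A J).
Variables (u w : I -> J -> B).
Hypothesis phi_psi : forall i i' j j' b,
  phi i i' (psi j j' b) = u i j * b * w i' j'.
Hypothesis wu1 : \sum_j \sum_i w i j * u i j = 1.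

(** The column u intertwines left multiplication on B with the composite matrix
    homomorphism: insert sum w u = 1 to the right of u b. *)
Lemma phi_psi_u i j b :
  \sum_j' \sum_i' phi i i' (psi j j' b) * u i' j' = u i j * b.
Proof.
rewrite -[RHS]mulr1 -wu1 mulr_sumr; apply: eq_bigr => j' _.
by rewrite mulr_sumr; apply: eq_bigr => i' _; rewrite phi_psi -!mulrA.
Qed.

(** The column u is a combination of columns in the image of phi, by
    [phi_psi_u] at b = 1, and these are fixed by phi(1). *)
Lemma phi1_u i j : \sum_i' phi i i' 1 * u i' j = u i j.
Proof.
have uE i1 := phi_psi_u i1 j 1.
rewrite -[RHS]mulr1 -uE.
under eq_bigr => i' _ do rewrite -[u i' j]mulr1 -uE mulr_sumr.
rewrite exchange_big; apply: eq_bigr => j' _ /=.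
under eq_bigr => i' _ do rewrite mulr_sumr.
rewrite exchange_big; apply: eq_bigr => i' _ /=.
under eq_bigr => i1 _ do rewrite mulrA.
by rewrite -mulr_suml -mh_mul mul1r.
Qed.

Section Iso.
Variable M : lmodType B.

Lemma comp_iso_in1 x j : [ffun i => u i j *: x] \in @mh_fixed _ _ _ phi M.
Proof.
apply: ind_inP => i; rewrite ffunE -[in RHS]phi1_u scaler_suml.
by apply: eq_bigr => i' _; rewrite ffunE scalerA.
Qed.

Lemma comp_iso_in2 x :
  [ffun j => Induced (comp_iso_in1 x j)]
    \in @mh_fixed _ _ _ psi (induced phi M).
Proof.
apply: ind_inP => j; rewrite ffunE; apply: ind_eqP => i.
rewrite ffunE -[in RHS](mulr1 (u i j)) -phi_psi_u scaler_suml ind_sumE.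
apply: eq_bigr => j' _; rewrite ind_scaleE scaler_suml.
by apply: eq_bigr => i' _; rewrite !ffunE scalerA.
Qed.

Definition comp_iso x : induced psi (induced phi M) := Induced (comp_iso_in2 x).

Lemma comp_isoE x j i : ind_val (ind_val (comp_iso x) j) i = u i j *: x.
Proof. by rewrite !ffunE. Qed.

Lemma comp_scaleE b (v : induced psi (induced phi M)) i j :
  ind_val (ind_val (b *: v) j) i =
    \sum_j' \sum_i' phi i i' (psi j j' b) *: ind_val (ind_val v j') i'.
Proof.
rewrite ind_scaleE ind_sumE.
by apply: eq_bigr => j' _; rewrite ind_scaleE.
Qed.

Lemma comp_iso_linear : linear comp_iso.
Proof.
move=> b x y; apply: ind_eqP => j; apply: ind_eqP => i.
rewrite ind_addE ind_addE comp_scaleE !comp_isoE scalerDr; congr (_ + _).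
rewrite scalerA -phi_psi_u scaler_suml; apply: eq_bigr => j' _.
by rewrite scaler_suml; apply: eq_bigr => i' _; rewrite comp_isoE scalerA.
Qed.

HB.instance Definition _ :=
  GRing.isLinear.Build B M (induced psi (induced phi M)) *:%R comp_iso
    comp_iso_linear.

Definition comp_iso_inv (v : induced psi (induced phi M)) : M :=
  \sum_j \sum_i w i j *: ind_val (ind_val v j) i.

Lemma comp_isoK : cancel comp_iso comp_iso_inv.
Proof.
move=> x; rewrite -[RHS]scale1r -wu1 scaler_suml; apply: eq_bigr => j _.
rewrite scaler_suml; apply: eq_bigr => i _.
by rewrite comp_isoE scalerA.
Qed.

Lemma comp_iso_invK : cancel comp_iso_inv comp_iso.
Proof.
move=> v; rewrite -[RHS]scale1r; apply: ind_eqP => j; apply: ind_eqP => i.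
rewrite comp_isoE comp_scaleE scaler_sumr; apply: eq_bigr => j' _.
rewrite scaler_sumr; apply: eq_bigr => i' _.
by rewrite phi_psi mulr1 scalerA.
Qed.
End Iso.

Section NatIso.
Variables (K : pzRingType) (iA : {rmorphism K -> A}) (iB : {rmorphism K -> B}).
Hypothesis phiK : forall i j k a, phi i j (iA k * a) = iB k * phi i j a.
Hypothesis psiK : forall i j k b, psi i j (iB k * b) = iA k * psi i j b.

Definition comp_nat_iso :
  natIsoToComp (ind_functor phiK) (ind_functor psiK).
Proof.
exists (fun M : lmodType B =>
  @comp_iso M : {linear M -> induced psi (induced phi M)}).
- move=> M; exists (@comp_iso_inv M); first exact: comp_isoK.
  exact: comp_iso_invK.
- move=> M N h x; apply: ind_eqP => j; apply: ind_eqP => i.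
  by rewrite !ind_mapE !comp_isoE linearZ_LR.
Defined.
End NatIso.
End CompositeIsomorphism.

(** * Full corners are Morita equivalent to the ring *)

(** The additive maps [emb] and [prj] identify A with the corner e B e of B,
    where e = emb 1, and [prj] is the compression b |-> e b e. *)
Section FullCorner.
Variables (K A B : pzRingType).
Variables (iA : {rmorphism K -> A}) (iB : {rmorphism K -> B}).
Variables (emb : {additive A -> B}) (prj : {additive B -> A}).
Hypothesis embM : {morph emb : a b / a * b}.
Hypothesis embK : cancel emb prj.
Hypothesis emb_prj : forall b, emb (prj b) = emb 1 * b * emb 1.
Hypothesis iB_central : forall k b, iB k * b = b * iB k.
Hypothesis emb_linear : forall k a, emb (iA k * a) = iB k * emb a.
Variables (J : finType) (s t : J -> B).
Hypothesis full : \sum_j s j * emb 1 * t j = 1.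

Lemma prjM b c : prj b * prj c = prj (b * emb 1 * c).
Proof.
apply: (can_inj embK); rewrite embM !emb_prj -!mulrA; congr (_ * (_ * _)).
by rewrite (mulrA (emb 1) (emb 1)) -embM mulr1.
Qed.

Lemma prj_linear k b : prj (iB k * b) = iA k * prj b.
Proof.
apply: (can_inj embK); rewrite emb_linear !emb_prj !mulrA.
by rewrite iB_central.
Qed.

Lemma prj1 : prj 1 = 1.
Proof. by apply: (can_inj embK); rewrite emb_prj mulr1 -embM mulr1. Qed.

Definition corner_emb : matrixHom A B 'I_1.
Proof.
apply: (@MatrixHom _ _ _ (fun _ _ => emb)) => [_ _|_ _ a b].
  exact: raddfB.
by rewrite big_ord1 embM.
Defined.

Definition corner_prj : matrixHom B A J.
Proof.
apply: (@MatrixHom _ _ _ (fun j l b => prj (t j * b * s l))) => j l b c.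
  by rewrite mulrBr mulrBl raddfB.
(* Insert 1 = sum_k s_k e t_k between b and c. *)
rewrite -{1}[b]mulr1 -full mulr_sumr mulr_suml mulr_sumr mulr_suml raddf_sum.
by apply: eq_bigr => k _; rewrite prjM !mulrA.
Defined.

Lemma full_corner_morita : morita_equivalent iA iB.
Proof.
have emb_lin (i j : 'I_1) k a :
  corner_emb i j (iA k * a) = iB k * corner_emb i j a by exact: emb_linear.
have prj_lin i j k b : corner_prj i j (iB k * b) = iA k * corner_prj i j b.
  by rewrite /= -prj_linear !mulrA iB_central.
exists (ind_functor prj_lin), (ind_functor emb_lin); split; constructor.
- apply: (@comp_nat_iso _ _ _ _ _ _
    (fun j _ => prj (t j)) (fun j _ => prj (s j))).
  + move=> i i' _ _ a /=; rewrite -{2}[a]embK !prjM; congr (prj _).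
    by rewrite -!mulrA; congr (_ * _); rewrite !mulrA -!embM mul1r mulr1.
  + rewrite big_ord1 -prj1 -full raddf_sum.
    by apply: eq_bigr => j _; rewrite prjM.
- apply: (@comp_nat_iso _ _ _ _ _ _
    (fun _ j => emb 1 * t j) (fun _ j => s j * emb 1)).
  + by move=> l l' j j' b; rewrite /= emb_prj !mulrA.
  + rewrite -full; apply: eq_bigr => j _.
    by rewrite big_ord1 !mulrA -[_ * emb 1 * emb 1]mulrA -embM mulr1.
Qed.
End FullCorner.


(** * The convolution algebra of an enlargement *)

Lemma idm_idempotent (E : finCategory) (X : ob E) : idempotent_at X (idm X).
Proof.
split; rewrite ?dom_idm ?cod_idm //.
by have := compose_idm_l (idm X); rewrite cod_idm.
Qed.

Section ConvolutionAlgebra.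
Variables (K : comPzRingType) (E : finCategory).

Lemma conv_scaleAl k (f g : convalg K E) : (k *: f) * g = k *: (f * g).
Proof. exact: conv_mulZl. Qed.

Lemma conv_scaleAr k (f g : convalg K E) : f * (k *: g) = k *: (f * g).
Proof. exact: conv_mulZr. Qed.

Lemma conv_linear_ext (V : lmodType K) (f g : convalg K E -> V) :
  linear f -> linear g -> (forall s, f (arrow K s) = g (arrow K s)) -> f =1 g.
Proof.
move=> fl gl fg x.
pose f' : {linear _ -> _} := HB.pack f (GRing.isLinear.Build _ _ _ _ f fl).
pose g' : {linear _ -> _} := HB.pack g (GRing.isLinear.Build _ _ _ _ g gl).
rewrite (conv_expand x) -[f]/(f' : _ -> _) -[g]/(g' : _ -> _) !linear_sum.
by apply: eq_bigr => s _; rewrite !linearZ_LR; congr (_ *: _); apply: fg.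
Qed.
End ConvolutionAlgebra.

Section Enlargement.
Variables (K : comPzRingType) (C D : finOrdInvCategory).
Variable i : ordInvSubcategory C D.
Hypothesis enl : is_enlargement i.
Local Notation KC := (convalg K C).
Local Notation KD := (convalg K D).

(** Fullness is applied to the identity idempotents, for which its
    hypotheses s e = s = f s are automatic. *)
Lemma enlargement_full (s : ar D) X Y :
  dom s = sub_ob i X -> cod s = sub_ob i Y -> exists s0, s = sub_ar i s0.
Proof.
move=> sX sY; apply: (enl_full enl (idm_idempotent X) (idm_idempotent Y) sX sY).
  by rewrite sub_idm -sX compose_idm_r.
by rewrite sub_idm -sY compose_idm_l.
Qed.

Lemma enlargement_cover (Y : ob D) : exists X (s : ar D),
  [/\ dom s = sub_ob i X, cod s = Y & ir_of s = idm Y].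
Proof.
have [X [e [s [_ sX sY _ sE]]]] := enl_cover enl (idm_idempotent Y).
by exists X, s.
Qed.

Definition conv_incl (f : KC) : KD :=
  \sum_s conv_coef f s *: arrow K (sub_ar i s).

Definition conv_restr (g : KD) : KC := [ffun s => conv_coef g (sub_ar i s)].

Lemma conv_incl_linear : linear conv_incl.
Proof.
move=> k f g; rewrite scaler_sumr -big_split; apply: eq_bigr => s _ /=.
by rewrite conv_coefD conv_coefZ scalerDl scalerA.
Qed.

Lemma conv_restr_linear : linear conv_restr.
Proof.
move=> k f g; apply/ffunP=> s.
by rewrite !ffunE conv_coefD conv_coefZ.
Qed.

HB.instance Definition _ :=
  GRing.isLinear.Build K KC KD *:%R conv_incl conv_incl_linear.
HB.instance Definition _ :=
  GRing.isLinear.Build K KD KC *:%R conv_restr conv_restr_linear.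

Lemma conv_incl_arrow s : conv_incl (arrow K s) = arrow K (sub_ar i s).
Proof.
rewrite /conv_incl (bigD1 s) //= conv_coef_arrow eqxx scale1r big1 ?addr0 //.
by move=> t /negPf ts; rewrite conv_coef_arrow ts scale0r.
Qed.

Lemma conv_restr_arrow s : conv_restr (arrow K (sub_ar i s)) = arrow K s.
Proof.
by apply/ffunP=> t; rewrite !ffunE conv_coef_arrow (inj_eq (@sub_ar_inj _ _ i)).
Qed.

Lemma conv_restr_arrow0 t :
  (forall s, t <> sub_ar i s) -> conv_restr (arrow K t) = 0.
Proof.
move=> tC; apply/ffunP=> s; rewrite !ffunE conv_coef_arrow.
by case: eqP => // /esym /tC.
Qed.

Lemma conv_inclK : cancel conv_incl conv_restr.
Proof.
move=> f; rewrite {2}(conv_expand f) linear_sum; apply: eq_bigr => s _.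
by rewrite linearZ_LR /= conv_restr_arrow.
Qed.

Lemma conv_inclM : {morph conv_incl : f g / f * g}.
Proof.
move=> f g; apply: (@conv_linear_ext _ _ _ (fun f => conv_incl (f * g))
  (fun f => conv_incl f * conv_incl g)) => {f}.
- by move=> k f f'; rewrite mulrDl conv_scaleAl linearP.
- by move=> k f f'; rewrite linearP mulrDl conv_scaleAl.
move=> s; apply: (@conv_linear_ext _ _ _ (fun g => conv_incl (arrow K s * g))
  (fun g => conv_incl (arrow K s) * conv_incl g)) => {g}.
- by move=> k f f'; rewrite mulrDr conv_scaleAr linearP.
- by move=> k f f'; rewrite linearP mulrDr conv_scaleAr.
move=> t; rewrite !conv_incl_arrow !arrowM.
have -> : composable (sub_ar i s) (sub_ar i t) = composable s t.
  by rewrite /composable sub_dom sub_cod (inj_eq (@sub_ob_inj _ _ i)).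
case: ifP => st; last exact: linear0.
by rewrite conv_incl_arrow sub_compose.
Qed.

(** The identity of dom t is an arrow of C, so t lies in B times the image of
    [conv_incl], on which right multiplication by [conv_incl 1] is the
    identity. *)
Lemma conv_incl1_mul_arrow (t : ar D) X :
  dom t = sub_ob i X -> arrow K t * conv_incl 1 = arrow K t.
Proof.
move=> tX; have tE : arrow K t = arrow K t * conv_incl (arrow K (idm X)).
  rewrite conv_incl_arrow sub_idm -tX arrowM /composable cod_idm eqxx.
  by rewrite compose_idm_r.
by rewrite {1}tE -mulrA -conv_inclM mulr1 -tE.
Qed.

Lemma conv_incl1E :
  conv_incl 1 = \sum_(a : ar C | a == idm (dom a)) arrow K (sub_ar i a).
Proof.
rewrite [1]/(conv_one K C) linear_sum.
by apply: eq_bigr => a _; apply: conv_incl_arrow.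
Qed.

(** An arrow of C is fixed by both sides.  On an arrow t outside C, a nonzero
    term of e t e would force both ends of t to be objects of C, against
    fullness. *)
Lemma conv_incl_restr g :
  conv_incl (conv_restr g) = conv_incl 1 * g * conv_incl 1.
Proof.
apply: (@conv_linear_ext _ _ _ (conv_incl \o conv_restr)
  (fun g => conv_incl 1 * g * conv_incl 1)) => {g}.
- by move=> k f g /=; rewrite !linearP.
- by move=> k f g; rewrite mulrDr mulrDl conv_scaleAr conv_scaleAl.
move=> t /=; have [s /eqP <-|tC] := pickP (fun s => sub_ar i s == t).
  by rewrite conv_restr_arrow -conv_incl_arrow -!conv_inclM mul1r mulr1.
rewrite conv_restr_arrow0 ?linear0 => [|s /esym/eqP]; last by rewrite tC.
rewrite conv_incl1E -mulrA [RHS]mulr_suml big1 // => a _.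
rewrite mulrA mulr_sumr big1 // => b _.
rewrite arrowM /composable; case: eqP => [at_|_]; last exact: mul0r.
rewrite arrowM /composable dom_compose //; case: eqP => // tb.
have [||s ts] := @enlargement_full t (cod b) (dom a);
  rewrite -?sub_dom -?sub_cod //.
by have := tC s; rewrite ts eqxx.
Qed.

(** An object Y is represented by its identity arrow and contributes
    s e s^o = s s^o = 1_Y, where s covers Y.  The other arrows of D contribute
    0, so that the finite type of all arrows can serve as index set. *)
Lemma conv_incl1_full : exists p : ar D -> KD * KD,
  \sum_a (p a).1 * conv_incl 1 * (p a).2 = 1.
Proof.
have /fin_all_exists[p pE] (a : ar D) : exists q : KD * KD,
    q.1 * conv_incl 1 * q.2 = if a == idm (dom a) then arrow K a else 0.
  case: eqP => [aE|_]; last by exists (0, 0); rewrite !mul0r.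
  have [X [s [sX _ sE]]] := enlargement_cover (dom a).
  have [sinv_dom sinv_cod _ _] := inv_inverse s.
  exists (arrow K s, arrow K (Defs.inv s)) => /=.
  rewrite (conv_incl1_mul_arrow sX) arrowM /composable sinv_cod eqxx.
  by rewrite -/(ir_of s) sE -aE.
by exists p; under eq_bigr => a _ do rewrite pE; rewrite -big_mkcond.
Qed.
End Enlargement.

Theorem theorem5p3 (K : comPzRingType) (C D : finOrdInvCategory)
    (i : ordInvSubcategory C D) :
  is_enlargement i ->
  morita_equivalent (conv_structure K C) (conv_structure K D).
Proof.
move=> enl; have [p pE] := conv_incl1_full K enl.
apply: (full_corner_morita (conv_inclM i) (conv_inclK i)
  (conv_incl_restr enl) _ _ pE).
  by move=> k f; rewrite [LHS]conv_scalarMl [RHS]conv_scalarMr.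
move=> k f; rewrite [RHS]conv_scalarMl -linearZ_LR.
by congr (conv_incl i _); apply: conv_scalarMl.
Qed.
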